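(* Let $\mathbb{X}$ be a Polish space and $c:\mathbb{X}\times\mathbb{X}\to\mathbb{R}\cup\{+\infty\}$ a symmetric cost. If $c$ is debiasable, then $\mathrm{OT}_c$ is debiasable. Moreover, if for any $\mu,\nu\in\mathcal{P}(\mathbb{X})$ a minimizer $\pi\in\Pi(\mu,\nu)$ exists in the definition of $\mathrm{OT}_c(\mu,\nu)$, then $c$ strictly debiasable implies that $\mathrm{OT}_c$ is strictly debiasable. Finally, if $\mathrm{OT}_c$ is debiasable (respectively strictly debiasable), then $c$ is debiasable (respectively strictly debiasable).
   Context: A symmetric function $C:\mathcal{X}\times\mathcal{X}\to\mathbb{R}\cup\{+\infty\}$ on a set $\mathcal{X}$ has debiased version $C_0(x,y)=C(x,y)-\tfrac12C(x,x)-\tfrac12C(y,y)$, with the rule $\infty-\infty=+\infty$. It is debiasable if $C_0\ge0$ everywhere, and strictly debiasable if moreover $C_0(x,y)>0$ for all $x\ne y$. For $\mu,\nu\in\mathcal{P}(\mathbb{X})$ (Borel probability measures), $\mathrm{OT}_c(\mu,\nu)=\inf_{\pi\in\Pi(\mu,\nu)}\int_{\mathbb{X}\times\mathbb{X}}c(x,y)\,d\pi(x,y)$, where $\Pi(\mu,\nu)$ is the set of couplings of $\mu$ and $\nu$. The cost $c$ is Borel measurable and these quantities are assumed well defined in $\mathbb{R}\cup\{+\infty\}$. *)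

(* Defs.v *)
From HB Require Import structures.
From mathcomp Require Import all_boot all_order all_algebra.
From mathcomp Require Import all_classical all_reals all_analysis.
From mathcomp Require Import measurable_realfun.

Set Implicit Arguments.
Unset Strict Implicit.
Unset Printing Implicit Defensive.

Import Order.TTheory GRing.Theory Num.Theory.

Local Open Scope classical_set_scope.
Local Open Scope ring_scope.
Local Open Scope ereal_scope.

Section debiasing.
Context {R : realType} {T : Type}.
Implicit Types C : T -> T -> \bar R.

(* C is symmetric with values in R U {+oo}. *)
Definition symmetric_cost C : Prop :=
  (forall x y, C x y = C y x) /\ (forall x y, -oo < C x y).

(* The addition of dual_ereal_scope satisfies +oo - +oo = +oo, whereas the
   addition of ereal_scope satisfies +oo - +oo = -oo. *)
Definition debiased C (x y : T) : \bar R :=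
  (C x y - 2^-1%:E * C x x - 2^-1%:E * C y y)%dE.

Definition debiasable C : Prop :=
  symmetric_cost C /\ forall x y, 0 <= debiased C x y.

(* Equality on T is a parameter because of measures, see [same_measure]. *)
Definition strictly_debiasable (eqT : T -> T -> Prop) C : Prop :=
  debiasable C /\ forall x y, ~ eqT x y -> 0 < debiased C x y.

End debiasing.

Section polish.
Context (R : realType).

Definition is_metric {T : Type} (d : T -> T -> R) : Prop :=
  [/\ forall x y, (0 <= d x y)%R,
      forall x y, d x y = 0%R <-> x = y,
      forall x y, d x y = d y x &
      forall x y z, (d x z <= d x y + d y z)%R].

Definition metrizes (T : topologicalType) (d : T -> T -> R) : Prop :=
  forall A : set T, open A <->
    forall x, A x -> exists2 e : R, (0 < e)%R & [set y | (d x y < e)%R] `<=` A.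

Definition complete_metric (T : topologicalType) (d : T -> T -> R) : Prop :=
  forall u : nat -> T,
    (forall e : R, (0 < e)%R ->
      exists N, forall m n, (N <= m)%N -> (N <= n)%N -> (d (u m) (u n) < e)%R) ->
    exists l : T, u @ \oo --> l.

Definition polish_space (T : topologicalType) : Prop :=
  (exists2 S : set T, countable S & dense S) /\
  exists d : T -> T -> R, [/\ is_metric d, metrizes d & complete_metric d].

End polish.

(* The join of the pointed and the topological structures of a product. *)
HB.instance Definition _ (S T : ptopologicalType) := Pointed.on (S * T)%type.

Definition borel (T : ptopologicalType) : measurableType (@open T).-sigma :=
  g_sigma_algebraType (@open T).

Section optimal_transport.
Context {R : realType} {X : ptopologicalType}.
Implicit Types (mu nu : probability (borel X) R) (c : X -> X -> \bar R).

(* A term of type [probability] is a function on all subsets of the space, and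
   its values on nonmeasurable sets are unconstrained; measures are thus
   compared on measurable sets only. *)
Definition same_measure mu nu : Prop :=
  forall A : set (borel X), measurable A -> mu A = nu A.

(* Couplings are Borel measures for the product topology on X * X. *)
Definition coupling mu nu : set (probability (borel (X * X)%type) R) :=
  [set pi | (forall A : set (borel X), measurable A ->
               pi (A `*` [set: X]) = mu A) /\
            (forall B : set (borel X), measurable B ->
               pi ([set: X] `*` B) = nu B)].

Definition transport_cost c (pi : probability (borel (X * X)%type) R) : \bar R :=
  \int[pi]_z c z.1 z.2.

Definition OT c mu nu : \bar R :=
  ereal_inf [set transport_cost c pi | pi in coupling mu nu].

Definition borel_measurable_cost c : Prop :=
  measurable_fun [set: borel (X * X)%type]
    (fun z : borel (X * X)%type => c z.1 z.2).

(* The positive and the negative parts of the cost never both have infinite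
   integral, and the infimum is not -oo. *)
Definition OT_well_defined c : Prop :=
  forall mu nu,
    (forall pi, coupling mu nu pi ->
       \int[pi]_z ((fun w : X * X => c w.1 w.2)^\+ z) < +oo \/
       \int[pi]_z ((fun w : X * X => c w.1 w.2)^\- z) < +oo) /\
    -oo < OT c mu nu.

Definition OT_minimizers_exist c : Prop :=
  forall mu nu, exists2 pi, coupling mu nu pi & transport_cost c pi = OT c mu nu.

End optimal_transport.

(* Main.v *)
Require Import Defs.
From HB Require Import structures.
From mathcomp Require Import all_boot all_order all_algebra.
From mathcomp Require Import all_classical all_reals all_analysis.
From mathcomp Require Import measurable_realfun.
From mathcomp Require Import lra.

Set Implicit Arguments.
Unset Strict Implicit.
Unset Printing Implicit Defensive.

Import Order.TTheory GRing.Theory Num.Theory.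

Local Open Scope classical_set_scope.
Local Open Scope ring_scope.
Local Open Scope ereal_scope.

(** The debiased cost c0 is nonnegative iff c(x,y) >= c(x,x)/2 + c(y,y)/2
    ([debiased_ge0]).  Integrating this pointwise inequality against a coupling
    pi of mu and nu makes the right-hand side split along the marginals,
    whence

      int c dpi >= 1/2 int c(x,x) dmu(x) + 1/2 int c(y,y) dnu(y).

    Transporting mu to itself along the diagonal costs int c(x,x) dmu, so the
    right-hand side is at least OT(mu,mu)/2 + OT(nu,nu)/2, and taking the
    infimum over pi gives debiasability of OT ([OT_debiasable]).

    Since c has no sign, splitting the integral needs care.  What makes it
    legitimate is that x |-> c(x,x) has an integrable negative part for every
    mu: its integral is the cost of the diagonal coupling, which is well
    defined and is not -oo because OT(mu,mu) > -oo
    ([self_cost_quasi_integrable]).  If int c dpi = +oo there is nothing to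
    prove, and otherwise a bound from below by a sum of two functions with
    integrable negative parts forces all three functions to be integrable
    ([lower_bound_integrable]).

    For strictness, take an optimal pi.  If OT(mu,nu) is finite and the debiased
    OT is not positive, the displayed inequality is an equality, so
    c(x,y) = c(x,x)/2 + c(y,y)/2 with finite values pi-almost everywhere
    ([integral_lower_bound_eq]).  Strict debiasability of c then puts pi on the
    diagonal, and a coupling carried by the diagonal has equal marginals
    ([coupling_on_diagonal]).

    Conversely, points of a metrizable space are Borel, so a coupling of two
    Dirac masses is carried by one point and OT(delta_x, delta_y) = c(x,y)
    ([OT_dirac]): the debiased cost is the restriction of the debiased OT to
    Dirac masses. *)

(** * Debiasing inequalities in the extended reals *)

Section ereal_arithmetic.
Context {R : realType}.
Implicit Types a b e : \bar R.

(** If b or e is +oo, the convention +oo - +oo = +oo makes the left-hand side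
    hold exactly when a = +oo, as does the right-hand side. *)
Lemma dual_sub2_ge0 a b e : -oo < a -> -oo < b -> -oo < e ->
  0 <= (a - b - e)%dE <-> b + e <= a.
Proof.
case: a b e => [a| |] [b| |] [e| |] //= _ _ _.
all: rewrite ?leey //=.
by rewrite -EFinD -!DualAddTheoryNumDomain.dEFinB !lee_fin -addrA -opprD subr_ge0.
Qed.

(** The guard [a < +oo] is necessary: the difference is +oo, hence positive, as
    soon as a = +oo, even when b + e = +oo. *)
Lemma dual_sub2_gt0 a b e : -oo < a -> -oo < b -> -oo < e ->
  0 < (a - b - e)%dE <-> (a < +oo -> b + e < a).
Proof.
case: a b e => [a| |] [b| |] [e| |] //= _ _ _.
all: rewrite ?ltry ?ltxx //=.
all: try by split => // /(_ isT).
rewrite -EFinD -!DualAddTheoryNumDomain.dEFinB !lte_fin -addrA -opprD subr_gt0.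
by split => [//|/(_ isT)].
Qed.

Lemma half_gtNy a : -oo < a -> -oo < 2^-1%:E * a.
Proof. by case: a => [a| |] // _; rewrite ?ltNyr // gt0_muley // lte_fin. Qed.

Lemma le_half a b : a <= b -> 2^-1%:E * a <= 2^-1%:E * b.
Proof. by move=> ab; rewrite lee_pmul2l // lte_fin. Qed.

End ereal_arithmetic.

Section debiased_inequalities.
Context {R : realType} {T : Type} (C : T -> T -> \bar R).
Hypothesis C_gtNy : forall x y, -oo < C x y.

Lemma debiased_ge0 x y :
  0 <= debiased C x y <-> 2^-1%:E * C x x + 2^-1%:E * C y y <= C x y.
Proof. by apply: dual_sub2_ge0 => //; exact: half_gtNy. Qed.

Lemma debiased_gt0 x y :
  0 < debiased C x y <->
  (C x y < +oo -> 2^-1%:E * C x x + 2^-1%:E * C y y < C x y).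
Proof. by apply: dual_sub2_gt0 => //; exact: half_gtNy. Qed.

End debiased_inequalities.

(** * Integrals bounded below by a sum *)

Section pointwise_parts.
Context {R : realType}.
Implicit Types a b e : \bar R.

Lemma neg_part_lower_bound a b e : -oo < a -> -oo < b -> a + b <= e ->
  maxe (- e) 0 <= maxe (- a) 0 + maxe (- b) 0.
Proof.
case: a b e => [a| |] [b| |] [e| |] //= _ _.
all: rewrite ?(max_r (leNye 0)) ?adde0 ?add0e.
all: try by rewrite ?leeNy_eq ?leye_eq // le_max lexx orbT.
all: try by rewrite ?adde_ge0 // le_max lexx orbT.
rewrite -EFinD -?EFinN -!EFin_max -EFinD !lee_fin /Num.max.
by do 3 case: ifP; lra.
Qed.

Lemma pos_part_lower_bound a b e : -oo < a -> -oo < b -> a + b <= e ->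
  maxe a 0 <= maxe e 0 + maxe (- b) 0.
Proof.
case: a b e => [a| |] [b| |] [e| |] //= _ _.
all: rewrite ?(max_r (leNye 0)) ?(max_l (leey 0)) ?addye ?leey //.
all: try by rewrite -?EFinN -EFin_max.
rewrite -EFinD -?EFinN -!EFin_max -EFinD !lee_fin /Num.max.
by do 3 case: ifP; lra.
Qed.

End pointwise_parts.

Section integral_of_lower_bound.
Context d (T : measurableType d) (R : realType).
Variable m : {measure set T -> \bar R}.
Implicit Types f g h k : T -> \bar R.

Lemma integrable_of_parts f : measurable_fun setT f ->
  \int[m]_x f^\+ x < +oo -> \int[m]_x f^\- x < +oo ->
  m.-integrable setT f.
Proof.
move=> mf fP fN; rewrite (funeposneg f); apply: integrableB => //.
  apply/integrableP; split; first exact: measurable_funepos.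
  by under eq_integral do rewrite gee0_abs //.
apply/integrableP; split; first exact: measurable_funeneg.
by under eq_integral do rewrite gee0_abs //.
Qed.

Lemma ge0_integral_lty_add k f g :
  measurable_fun setT k -> measurable_fun setT f -> measurable_fun setT g ->
  (forall x, 0 <= k x) -> (forall x, 0 <= f x) -> (forall x, 0 <= g x) ->
  (forall x, k x <= f x + g x) ->
  \int[m]_x f x < +oo -> \int[m]_x g x < +oo -> \int[m]_x k x < +oo.
Proof.
move=> mk mf mg k0 f0 g0 kfg foo goo.
apply: (@le_lt_trans _ _ (\int[m]_x (f x + g x))).
  by apply: ge0_le_integral => //; exact: emeasurable_funD.
by rewrite ge0_integralD // lte_add_pinfty.
Qed.

Variables (f g h : T -> \bar R).
Hypotheses (mf : measurable_fun setT f) (mg : measurable_fun setT g)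
  (mh : measurable_fun setT h).
Hypotheses (g_gtNy : forall x, -oo < g x) (h_gtNy : forall x, -oo < h x).
Hypothesis gh_le : forall x, g x + h x <= f x.
Hypotheses (gN : \int[m]_x g^\- x < +oo) (hN : \int[m]_x h^\- x < +oo).

(** From g + h <= f, the negative part of f is at most the sum of those of g
    and h, and the positive part of g is at most that of f plus the negative
    part of h; so finiteness of the integral of f propagates to every part. *)
Lemma lower_bound_integrable : \int[m]_x f x < +oo ->
  [/\ m.-integrable setT f, m.-integrable setT g & m.-integrable setT h].
Proof.
move=> foo.
have fN : \int[m]_x f^\- x < +oo.
  apply: (@ge0_integral_lty_add _ g^\- h^\-) => //;
    try exact: measurable_funeneg.
  by move=> x; rewrite !funenegE; exact: neg_part_lower_bound.
have fP : \int[m]_x f^\+ x < +oo.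
  rewrite ltNge leye_eq; apply/eqP => fPy; move: foo.
  by rewrite integralE fPy; case: (\int[m]_x f^\- x) fN.
split; apply: integrable_of_parts => //.
- apply: (@ge0_integral_lty_add _ f^\+ h^\-) => //;
    try exact: measurable_funepos; try exact: measurable_funeneg.
  by move=> x; rewrite !funeposE funenegE; exact: pos_part_lower_bound.
- apply: (@ge0_integral_lty_add _ f^\+ g^\-) => //;
    try exact: measurable_funepos; try exact: measurable_funeneg.
  move=> x; rewrite !funeposE funenegE; apply: pos_part_lower_bound => //.
  by rewrite addeC.
Qed.

Lemma integral_lower_bound : \int[m]_x g x + \int[m]_x h x <= \int[m]_x f x.
Proof.
have [->|] := eqVneq (\int[m]_x f x) +oo; first exact: leey.
rewrite -ltey => /lower_bound_integrable[fi gi hi].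
rewrite -integralD //; apply: le_integral => //.
exact: integrableD.
Qed.

(** Finiteness of the values matters in the conclusion: on the null set where
    f = +oo, the equality f = g + h would not contradict a strict inequality
    that is known only where f is finite. *)
Lemma integral_lower_bound_eq : \int[m]_x f x < +oo ->
  \int[m]_x f x <= \int[m]_x g x + \int[m]_x h x ->
  {ae m, forall x, f x \is a fin_num /\ f x = g x + h x}.
Proof.
move=> foo fgh; have [fi gi hi] := lower_bound_integrable foo.
have ghi : m.-integrable setT (g \+ h) by exact: integrableD.
have mgh := measurable_int m ghi.
have mk : measurable_fun setT (f \- (g \+ h)) by exact: emeasurable_funB.
have f_fin := integrable_ae measurableT fi.
have k_ge0 x : f x \is a fin_num -> 0 <= f x - (g x + h x).
  by move=> fx; rewrite sube_ge0 ?fx ?orbT.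
(* The difference f - (g + h) equals +oo - +oo = -oo where both sides are +oo,
   so it is nonnegative only almost everywhere; its positive part is
   nonnegative everywhere and has the same integral. *)
have : \int[m]_x `|(f \- (g \+ h))^\+ x| = 0.
  apply/eqP; rewrite eq_le integral_ge0 // andbT.
  rewrite (_ : integral _ _ _ = \int[m]_x (f x - (g x + h x))); last first.
    apply: ae_eq_integral => //.
      by apply: measurableT_comp => //; exact: measurable_funepos.
    apply: filterS f_fin => x /(_ I) fx _.
    by rewrite gee0_abs // funeposE max_l //; exact: k_ge0.
  rewrite integralB // integralD // sube_le0 //.
move/(ae_eq_integral_abs _ measurableT (measurable_funepos mk)) => k0.
apply: filterS2 f_fin k0 => x /(_ I) fx /(_ I); rewrite funeposE /= => k0.
split=> //; apply/eqP; rewrite eq_le gh_le andbT.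
have : f x - (g x + h x) <= 0 by rewrite -[leRHS]k0 le_max lexx.
rewrite sube_le0 //.
Qed.

End integral_of_lower_bound.

(** The value may be +oo; the finite integral of the negative part excludes
    +oo - +oo, so multiplication distributes over the difference of parts. *)
Lemma integral_half d (T : measurableType d) (R : realType)
    (m : {measure set T -> \bar R}) (f : T -> \bar R) :
  measurable_fun setT f -> \int[m]_x f^\- x < +oo ->
  \int[m]_x (2^-1%:E * f x) = 2^-1%:E * \int[m]_x f x.
Proof.
move=> mf fN; have half0 : (0 <= 2^-1 :> R)%R by [].
rewrite integralE ge0_funeposM // ge0_funenegM //.
rewrite !ge0_integralZl_EFin //; [|exact: measurable_funeneg|exact: measurable_funepos].
rewrite [in RHS]integralE [RHS]muleBr //.
apply: fin_num_adde_defl; rewrite fin_numN ge0_fin_numE //.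
exact: integral_ge0.
Qed.

(** * Images of measures and Borel maps *)

Section image_measure.
Context d1 d2 (T1 : measurableType d1) (T2 : measurableType d2) (R : realType).

(** The second measure is only required to agree with the image measure on
    measurable sets, as the marginals of a coupling do.  The rule holds for both
    parts of f separately, hence also when the integral is infinite. *)
Lemma integral_image (m1 : {measure set T1 -> \bar R})
    (m2 : {measure set T2 -> \bar R}) (phi : T1 -> T2) (f : T2 -> \bar R) :
  measurable_fun setT phi ->
  (forall A, measurable A -> m1 (phi @^-1` A) = m2 A) ->
  measurable_fun setT f ->
  \int[m1]_x f (phi x) = \int[m2]_y f y.
Proof.
move=> mphi m12 mf.
pose phi' : {mfun T1 >-> T2} :=
  HB.pack phi (isMeasurableFun.Build _ _ _ _ phi mphi).
have ge0_case (g : T2 -> \bar R) : measurable_fun setT g ->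
    (forall y, 0 <= g y) -> \int[m1]_x g (phi x) = \int[m2]_y g y.
  move=> mg g0.
  transitivity (\int[pushforward m1 phi']_y g y); last first.
    by apply: eq_measure_integral => A mA _; exact: m12.
  by rewrite ge0_integral_pushforward.
rewrite integralE [RHS]integralE; congr (_ - _).
  rewrite -(ge0_case f^\+) //; last exact: measurable_funepos.
  by apply: eq_integral => x _; rewrite !funeposE.
rewrite -(ge0_case f^\-) //; last exact: measurable_funeneg.
by apply: eq_integral => x _; rewrite !funenegE.
Qed.

End image_measure.

Section borel_maps.
Context {S T : ptopologicalType}.

Lemma continuous_borel (f : S -> T) :
  continuous f -> measurable_fun [set: borel S] (f : borel S -> borel T).
Proof.
move=> /continuousP cf.
apply: (@measurability _ _ (borel S) (borel T) setT f (@open T)) => //.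
by move=> _ [B oB <-]; rewrite setTI; apply: sub_sigma_algebra; exact: cf.
Qed.

End borel_maps.

Section image_probability.
Context d1 d2 (T1 : measurableType d1) (T2 : measurableType d2) (R : realType).

Lemma image_probability (P : probability T1 R) (phi : T1 -> T2) :
  measurable_fun setT phi ->
  exists Q : probability T2 R, forall A, Q A = P (phi @^-1` A).
Proof.
move=> mphi.
pose phi' : {mfun T1 >-> T2} :=
  HB.pack phi (isMeasurableFun.Build _ _ _ _ phi mphi).
by exists (distribution P phi').
Qed.

End image_probability.

Lemma metrizable_measurable_set1 (R : realType) (X : ptopologicalType)
    (d : X -> X -> R) (x : X) :
  is_metric d -> metrizes d -> measurable ([set x] : set (borel X)).
Proof.
move=> [d0 d_eq0 _ _] dX; rewrite -(setCK [set x]); apply: measurableC.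
apply: sub_sigma_algebra; apply/dX => y /= yx; exists (d y x).
  by rewrite lt_neqAle d0 andbT eq_sym; apply/eqP => /d_eq0.
by move=> z /= + zx; rewrite zx ltxx.
Qed.

(** * Couplings *)

Section couplings.
Context {R : realType} {X : ptopologicalType}.
Implicit Types (mu nu : probability (borel X) R) (c : X -> X -> \bar R).
Implicit Types (pi : probability (borel (X * X)%type) R).

Lemma borel_fst :
  measurable_fun [set: borel (X * X)%type] (fst : borel (X * X)%type -> borel X).
Proof. by apply: continuous_borel => z; exact: cvg_fst. Qed.

Lemma borel_snd :
  measurable_fun [set: borel (X * X)%type] (snd : borel (X * X)%type -> borel X).
Proof. by apply: continuous_borel => z; exact: cvg_snd. Qed.

Lemma borel_swap : measurable_fun [set: borel (X * X)%type]
  (@unstable.swap X X : borel (X * X)%type -> borel (X * X)%type).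
Proof. by apply: continuous_borel; exact: swap_continuous. Qed.

Lemma borel_diagonal : measurable_fun [set: borel X]
  ((fun x => (x, x)) : borel X -> borel (X * X)%type).
Proof. by apply: continuous_borel => x; apply: cvg_pair; exact: cvg_id. Qed.

Lemma coupling_integral_fst mu nu pi (g : borel X -> \bar R) :
  coupling mu nu pi -> measurable_fun setT g ->
  \int[pi]_z g z.1 = \int[mu]_x g x.
Proof.
move=> [pimu _] mg; apply: (integral_image borel_fst) => // A mA.
rewrite -[RHS](pimu A mA); congr (pi _).
by apply/seteqP; split=> z //= [].
Qed.

Lemma coupling_integral_snd mu nu pi (g : borel X -> \bar R) :
  coupling mu nu pi -> measurable_fun setT g ->
  \int[pi]_z g z.2 = \int[nu]_x g x.
Proof.
move=> [_ pinu] mg; apply: (integral_image borel_snd) => // A mA.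
rewrite -[RHS](pinu A mA); congr (pi _).
by apply/seteqP; split=> z //= [].
Qed.

(** Exchanging the two coordinates of a plan is what makes OT symmetric. *)
Lemma swapped_coupling mu nu pi : coupling mu nu pi ->
  exists2 rho, coupling nu mu rho &
    forall f : borel (X * X)%type -> \bar R, measurable_fun setT f ->
      \int[rho]_z f z = \int[pi]_z f (unstable.swap z).
Proof.
move=> [pimu pinu]; have [rho rhoE] := image_probability pi borel_swap.
exists rho; last first.
  move=> f mf; apply/esym/(integral_image borel_swap) => // A _.
  exact/esym/rhoE.
split=> A mA; rewrite rhoE.
  rewrite -[RHS](pinu A mA); congr (pi _).
  by apply/seteqP; split=> -[x y] [].
rewrite -[RHS](pimu A mA); congr (pi _).
by apply/seteqP; split=> -[x y] [].
Qed.

(** The plan that leaves all mass in place is the competitor that bounds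
    OT(mu,mu) by the integral of c(x,x). *)
Lemma diagonal_coupling mu : exists2 rho, coupling mu mu rho &
  forall f : borel (X * X)%type -> \bar R, measurable_fun setT f ->
    \int[rho]_z f z = \int[mu]_x f (x, x).
Proof.
have [rho rhoE] := image_probability mu borel_diagonal.
exists rho; last first.
  move=> f mf; apply/esym/(integral_image borel_diagonal) => // A _.
  exact/esym/rhoE.
by split=> A mA; rewrite rhoE; congr (mu _); apply/seteqP; split=> x //= [].
Qed.

(** Off a null set carrying the pairs of distinct points, the cylinders A * X
    and X * A coincide. *)
Lemma coupling_on_diagonal mu nu pi : coupling mu nu pi ->
  {ae pi, forall z, z.1 = z.2} -> same_measure mu nu.
Proof.
move=> [pimu pinu] [N [mN N0 offN]] A mA; rewrite -pimu // -pinu //.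
have mA1 : measurable (A `*` [set: X] : set (borel (X * X)%type)).
  have := borel_fst measurableT mA; rewrite setTI.
  by congr measurable; apply/seteqP; split=> z //= [].
have mA2 : measurable ([set: X] `*` A : set (borel (X * X)%type)).
  have := borel_snd measurableT mA; rewrite setTI.
  by congr measurable; apply/seteqP; split=> z //= [].
rewrite -(measureU0 mA1 mN N0) -(measureU0 mA2 mN N0); congr (pi _).
apply/seteqP; split=> z [[Az1 Az2]|]; try by right.
  by have [zE|/offN] := pselect (z.1 = z.2); [left; split=> //=; rewrite -zE|right].
by have [zE|/offN] := pselect (z.1 = z.2); [left; split=> //=; rewrite zE|right].
Qed.

End couplings.

(** * From the cost to optimal transport *)

Section optimal_transport_theory.
Context {R : realType} {X : ptopologicalType} (c : X -> X -> \bar R).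
Implicit Types (mu nu : probability (borel X) R).
Implicit Types (pi : probability (borel (X * X)%type) R).
Hypotheses (c_meas : borel_measurable_cost c) (c_sym : symmetric_cost c).

Lemma OT_le mu nu pi : coupling mu nu pi -> OT c mu nu <= transport_cost c pi.
Proof. by move=> pi_mn; apply: ereal_inf_lbound; exists pi. Qed.

Lemma OT_symmetric mu nu : OT c mu nu = OT c nu mu.
Proof.
have [cC _] := c_sym.
have le mu' nu' : OT c mu' nu' <= OT c nu' mu'.
  apply: le_ereal_inf_tmp => _ [pi /swapped_coupling[rho mn rhoE] <-].
  rewrite (le_trans (OT_le mn)) // /transport_cost rhoE //.
  by under eq_integral do rewrite cC.
by apply/eqP; rewrite eq_le !le.
Qed.

Hypothesis c_wd : OT_well_defined c.

Let self_cost (x : borel X) := c x x.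
Let half_self_cost (x : borel X) := 2^-1%:E * self_cost x.

Let self_cost_meas : measurable_fun setT self_cost.
Proof. exact: (measurableT_comp c_meas borel_diagonal). Qed.

Let half_self_cost_meas : measurable_fun setT half_self_cost.
Proof. exact: measurable_funeM. Qed.

(** The integral of c(x,x) is the cost of the diagonal coupling, so it is bounded
    below by OT(mu,mu) > -oo.  If the negative part had an infinite integral,
    the positive one would not, and this cost would be -oo. *)
Lemma self_cost_quasi_integrable mu :
  OT c mu mu <= \int[mu]_x self_cost x /\ \int[mu]_x self_cost^\- x < +oo.
Proof.
have [rho rho_mu rhoE] := diagonal_coupling mu.
have [wd OTNy] := c_wd mu mu.
have OTle : OT c mu mu <= \int[mu]_x self_cost x.
  by have := OT_le rho_mu; rewrite /transport_cost rhoE.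
split=> //; have := lt_le_trans OTNy OTle; rewrite integralE.
have : 0 <= \int[mu]_x self_cost^\+ x by exact: integral_ge0.
have : 0 <= \int[mu]_x self_cost^\- x by exact: integral_ge0.
have rhoP : \int[mu]_x self_cost^\+ x =
    \int[rho]_z (fun w : X * X => c w.1 w.2)^\+ z.
  rewrite rhoE; last exact: measurable_funepos c_meas.
  by apply: eq_integral => x _; rewrite !funeposE.
have rhoN : \int[mu]_x self_cost^\- x =
    \int[rho]_z (fun w : X * X => c w.1 w.2)^\- z.
  rewrite rhoE; last exact: measurable_funeneg c_meas.
  by apply: eq_integral => x _; rewrite !funenegE.
have := wd _ rho_mu; rewrite -rhoP -rhoN.
case: (\int[mu]_x self_cost^\- x) => [r| |] //; first by rewrite ltry.
by case: (\int[mu]_x self_cost^\+ x) => [r| |] // [].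
Qed.

Lemma half_self_cost_quasi_integrable mu :
  2^-1%:E * OT c mu mu <= \int[mu]_x half_self_cost x /\
  \int[mu]_x half_self_cost^\- x < +oo.
Proof.
have [OTle cN] := self_cost_quasi_integrable mu.
split; first by rewrite integral_half // le_half.
rewrite ge0_funenegM // ge0_integralZl_EFin //; last exact: measurable_funeneg.
by rewrite lte_mul_pinfty.
Qed.

Section debiasable_cost.
Hypothesis c_deb : debiasable c.
Variables (mu nu : probability (borel X) R).
Variable pi : probability (borel (X * X)%type) R.
Hypothesis pi_mn : coupling mu nu pi.

Let half_gtNy x : -oo < half_self_cost x.
Proof. by apply: half_gtNy; exact: c_sym.2. Qed.

Let half_le (z : borel (X * X)%type) :
  half_self_cost z.1 + half_self_cost z.2 <= c z.1 z.2.
Proof. by apply/debiased_ge0; [exact: c_sym.2|exact: c_deb.2]. Qed.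

Let half_fst_neg : \int[pi]_z (half_self_cost \o fst)^\- z < +oo.
Proof.
have := coupling_integral_fst pi_mn (measurable_funeneg half_self_cost_meas).
have [_ negN] := half_self_cost_quasi_integrable mu.
under eq_integral do rewrite funenegE.
under [in X in X < _]eq_integral do rewrite funenegE.
by move=> ->.
Qed.

Let half_snd_neg : \int[pi]_z (half_self_cost \o snd)^\- z < +oo.
Proof.
have := coupling_integral_snd pi_mn (measurable_funeneg half_self_cost_meas).
have [_ negN] := half_self_cost_quasi_integrable nu.
under eq_integral do rewrite funenegE.
under [in X in X < _]eq_integral do rewrite funenegE.
by move=> ->.
Qed.

Let OT_half_le_integral :
  2^-1%:E * OT c mu mu + 2^-1%:E * OT c nu nu <=
  \int[pi]_z half_self_cost z.1 + \int[pi]_z half_self_cost z.2.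
Proof.
rewrite (coupling_integral_fst pi_mn) // (coupling_integral_snd pi_mn) //.
by apply: leeD; apply: (half_self_cost_quasi_integrable _).1.
Qed.

Let half_fst_meas :
  measurable_fun [set: borel (X * X)%type] (half_self_cost \o fst).
Proof. exact: (measurableT_comp half_self_cost_meas borel_fst). Qed.

Let half_snd_meas :
  measurable_fun [set: borel (X * X)%type] (half_self_cost \o snd).
Proof. exact: (measurableT_comp half_self_cost_meas borel_snd). Qed.

Lemma debiasable_transport_cost_ge :
  2^-1%:E * OT c mu mu + 2^-1%:E * OT c nu nu <= transport_cost c pi.
Proof.
apply: (le_trans OT_half_le_integral).
exact: (integral_lower_bound c_meas half_fst_meas half_snd_meas
  (fun z => half_gtNy z.1) (fun z => half_gtNy z.2) half_le
  half_fst_neg half_snd_neg).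
Qed.

(** Equality in the integrated inequality forces it pointwise, since the
    integrand of the difference is nonnegative. *)
Lemma debiasable_transport_cost_eq :
  transport_cost c pi < +oo ->
  transport_cost c pi <= 2^-1%:E * OT c mu mu + 2^-1%:E * OT c nu nu ->
  {ae pi, forall z, c z.1 z.2 \is a fin_num /\
    c z.1 z.2 = half_self_cost z.1 + half_self_cost z.2}.
Proof.
move=> coo /le_trans/(_ OT_half_le_integral) c_le.
exact: (integral_lower_bound_eq c_meas half_fst_meas half_snd_meas
  (fun z => half_gtNy z.1) (fun z => half_gtNy z.2) half_le
  half_fst_neg half_snd_neg coo c_le).
Qed.

End debiasable_cost.

Lemma OT_debiasable : debiasable c -> debiasable (OT c).
Proof.
move=> c_deb; have OT_gtNy mu nu : -oo < OT c mu nu by have [] := c_wd mu nu.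
split; first by split; [exact: OT_symmetric|].
move=> mu nu; apply/debiased_ge0 => //.
apply: le_ereal_inf_tmp => _ [pi pi_mn <-].
exact: debiasable_transport_cost_ge.
Qed.

(** If the strict inequality failed at a minimizer, this minimizer would be
    carried by the diagonal, and mu and nu would agree on measurable sets. *)
Lemma OT_strictly_debiasable : OT_minimizers_exist c ->
  strictly_debiasable eq c -> strictly_debiasable same_measure (OT c).
Proof.
move=> c_min [c_deb c_strict]; split; first exact: OT_debiasable.
have OT_gtNy mu nu : -oo < OT c mu nu by have [] := c_wd mu nu.
move=> mu nu mu_nu; apply/debiased_gt0 => //.
have [pi pi_mn <-] := c_min mu nu => coo.
rewrite ltNge; apply/negP => c_le; apply: mu_nu.
apply: (coupling_on_diagonal pi_mn).
have ae_pi : Filter (nbhs (almost_everywhere pi)) :=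
  ae_filter_ringOfSetsType pi.
apply: filterS (debiasable_transport_cost_eq c_deb pi_mn coo c_le).
move=> z [c_fin cE]; apply: contrapT => /c_strict /debiased_gt0.
move=> /(_ c_sym.2); rewrite ltey_eq c_fin => /(_ isT).
by rewrite cE ltxx.
Qed.

End optimal_transport_theory.

(** * From optimal transport to the cost: Dirac masses *)

Section dirac_masses.
Context {R : realType} {X : ptopologicalType} (c : X -> X -> \bar R).
Hypothesis c_meas : borel_measurable_cost c.
Hypothesis mset1 : forall x, measurable ([set x] : set (borel X)).

Let delta (x : X) : probability (borel X) R := dirac (x : borel X).

Lemma delta_inj x y : same_measure (delta x) (delta y) -> x = y.
Proof.
move=> /(_ _ (mset1 x)); rewrite /= !diracE in_set1 eqxx.
by rewrite in_set1; case: eqP => [->//|_ /eqP]; rewrite eqe oner_eq0.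
Qed.

Lemma dirac_pair_coupling x y :
  coupling (delta x) (delta y) (dirac ((x, y) : borel (X * X)%type)).
Proof.
by split=> A mA; rewrite /= !diracE; congr (_%:R%:E); congr nat_of_bool;
  apply/idP/idP; rewrite !inE //= => -[].
Qed.

(** The plan gives no mass to z.1 <> x nor to z.2 <> y, so the cost is
    almost everywhere the constant c(x,y), which may be +oo. *)
Lemma transport_cost_dirac x y pi :
  coupling (delta x) (delta y) pi -> transport_cost c pi = c x y.
Proof.
move=> [pix piy].
have pi1 : {ae pi, forall z, z.1 = x}.
  exists (~` [set x] `*` setT); split.
  - have := borel_fst measurableT (measurableC (mset1 x)); rewrite setTI.
    by congr measurable; apply/seteqP; split=> z //= [].
  - rewrite pix; last exact: measurableC.
    by rewrite /= diracE memNset //= => /(_ erefl).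
  - by move=> z.
have pi2 : {ae pi, forall z, z.2 = y}.
  exists (setT `*` ~` [set y]); split.
  - have := borel_snd measurableT (measurableC (mset1 y)); rewrite setTI.
    by congr measurable; apply/seteqP; split=> z //= [].
  - rewrite piy; last exact: measurableC.
    by rewrite /= diracE memNset //= => /(_ erefl).
  - by move=> z.
rewrite /transport_cost (ae_eq_integral (cst (c x y))) //.
  rewrite integral_cst // -[RHS]mule1; congr (_ * _).
  exact: probability_setT.
have ae_pi : Filter (nbhs (almost_everywhere pi)) :=
  ae_filter_ringOfSetsType pi.
by apply: filterS2 pi1 pi2 => z -> ->.
Qed.

Lemma OT_dirac x y : OT c (delta x) (delta y) = c x y.
Proof.
have cpl := dirac_pair_coupling x y.
apply/eqP; rewrite eq_le; apply/andP; split.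
  by rewrite -(transport_cost_dirac cpl); exact: OT_le.
by apply: le_ereal_inf_tmp => _ [pi /transport_cost_dirac -> <-].
Qed.

Lemma debiased_OT_dirac x y :
  debiased (OT c) (delta x) (delta y) = debiased c x y.
Proof. by rewrite /debiased !OT_dirac. Qed.

Lemma debiasable_of_OT : symmetric_cost c -> debiasable (OT c) -> debiasable c.
Proof.
by move=> c_sym [_ OT0]; split=> // x y; rewrite -debiased_OT_dirac.
Qed.

Lemma strictly_debiasable_of_OT : symmetric_cost c ->
  strictly_debiasable same_measure (OT c) -> strictly_debiasable eq c.
Proof.
move=> c_sym [OT_deb OT0]; split; first exact: debiasable_of_OT.
move=> x y xy; rewrite -debiased_OT_dirac; apply: OT0.
by move=> /delta_inj.
Qed.

End dirac_masses.

Theorem proposition3p2 (R : realType) (X : ptopologicalType)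
    (c : X -> X -> \bar R) :
  polish_space R X ->
  borel_measurable_cost c ->
  symmetric_cost c ->
  OT_well_defined c ->
  (debiasable c -> debiasable (OT c)) /\
  (OT_minimizers_exist c ->
     strictly_debiasable eq c -> strictly_debiasable same_measure (OT c)) /\
  (debiasable (OT c) -> debiasable c) /\
  (strictly_debiasable same_measure (OT c) -> strictly_debiasable eq c).
Proof.
move=> [_ [d [d_metric d_X _]]] c_meas c_sym c_wd.
have mset1 x := metrizable_measurable_set1 x d_metric d_X.
split; first exact: OT_debiasable.
split; first exact: OT_strictly_debiasable.
split; first exact: debiasable_of_OT.
exact: strictly_debiasable_of_OT.
Qed.
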